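(* Let $\{S(t): t\ge 0\}$ be a semigroup on a nonempty closed subset $V$ of a Banach space $(X,\|\cdot\|_X)$, $T>0$ and $\mathbf{B}\subseteq V$ be a bounded absorbing set for the semigroup. Moreover, let $\{S(t): t\ge 0\}$ be asymptotically closed or $\mathbf{B}$ be closed. If the semigroup satisfies the smoothing property on $\mathbf{B}$ at time $T$ with parameters $(\eta,\kappa)$, then for any $\sigma\in(0,1-\eta)$ there exists a $T$-discrete exponential attractor $\mathbf{M_0}\subseteq\mathbf{B}$ for the semigroup and $$\dim_f^{V}(\mathbf{M_0})\le\begin{cases}\log_{\frac{1}{\eta+\sigma}}m_{\|\cdot\|_X}\left(\overline{B}^Z(0,1),\frac{\sigma}{2\kappa}\right)&\text{if alternative (i) of the smoothing property holds},\\ \log_{\frac{1}{\eta+\sigma}}m_{\|\cdot\|_Y}\left(\overline{B}^X(0,1),\frac{\sigma}{2\kappa}\right)&\text{if alternative (ii) of the smoothing property holds}.\end{cases}$$ If the semigroup is asymptotically closed, then it has a global attractor $\mathbf{A}$ contained in $\mathbf{M_0}$.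
   Context: $V$ carries the metric $d(x,y)=\|x-y\|_X$. A semigroup $\{S(t):t\ge0\}$ on $V$ is a family of (not necessarily linear) maps $S(t):V\to V$ with $S(t)S(s)=S(t+s)$ for $t,s\ge 0$ and $S(0)=I$; ''$t\ge 0$'' means throughout either $t\in[0,\infty)$ or $t\in\mathbb{N}_0$ (and $T$ belongs to the time set). Smoothing property on $B\subseteq V$ at time $T>0$ with parameters $(\eta,\kappa)$: $S(T)=C(T)+M(T)$ on $B$, where $\eta\in[0,1)$, $\kappa>0$, $$\|C(T)x-C(T)y\|_X\le\eta\|x-y\|_X,\quad x,y\in B,$$ and one of the following holds: (i) $M(T):B\to Z$, where $Z$ is an auxiliary normed space compactly embedded into $X$, and $\|M(T)x-M(T)y\|_Z\le\kappa\|x-y\|_X$ for $x,y\in B$; (ii) $X$ is compactly embedded into a normed space $Y$ and $\|M(T)x-M(T)y\|_X\le\kappa\|x-y\|_Y$ for $x,y\in B$. Asymptotically closed: for any $t\ge 0$, $t_k\ge 0$ with $t_k\to\infty$ and any bounded sequence $x_k\in V$, if $S(t_k)x_k\to x$ and $S(t+t_k)x_k\to y$ with $x,y\in V$, then $S(t)x=y$. Absorbing set: $\mathbf{B}\subseteq V$ such that for every bounded $G\subseteq V$ there is $t_G\ge 0$ with $S(t)G\subseteq\mathbf{B}$ for all $t\ge t_G$. $\overline{B}^Z(0,1)$ is the closed unit ball of $Z$; $m_{\|\cdot\|_Y}(F,\varepsilon)$ is the maximal cardinality of a subset $U\subseteq F$ with $\|x-y\|_Y\ge\varepsilon$ for all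 $x,y\in U$, $x\neq y$. $\mathrm{dist}^V(G,H)=\sup_{x\in G}\inf_{y\in H}d(x,y)$. $N^V(G,\varepsilon)$ is the minimal number of open $\varepsilon$-balls in $V$ centered at points of $G$ needed to cover $G$; $\dim_f^V(G)=\limsup_{\varepsilon\to0^+}\log_{1/\varepsilon}N^V(G,\varepsilon)$. Global attractor: a nonempty compact set $\mathbf{A}\subseteq V$ with $S(t)\mathbf{A}=\mathbf{A}$ for all $t\ge 0$ and $\lim_{t\to\infty}\mathrm{dist}^V(S(t)G,\mathbf{A})=0$ for every bounded $G\subseteq V$. $T$-discrete exponential attractor: a nonempty compact set $\mathbf{M_0}\subseteq V$ such that $S(T)\mathbf{M_0}\subseteq\mathbf{M_0}$, $\dim_f^V(\mathbf{M_0})<\infty$, and there is $\xi>0$ with $\lim_{t\to\infty}e^{\xi t}\mathrm{dist}^V(S(t)G,\mathbf{M_0})=0$ for every bounded $G\subseteq V$. *)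

(* Defs.v *)
From HB Require Import structures.
From mathcomp Require Import all_boot all_order all_algebra finmap.
From mathcomp Require Import all_classical all_reals all_analysis.

Set Implicit Arguments.
Unset Strict Implicit.
Unset Printing Implicit Defensive.

Import Order.TTheory GRing.Theory Num.Theory.
Import numFieldNormedType.Exports.

Local Open Scope classical_set_scope.
Local Open Scope ring_scope.

(* Extended-real logarithm to base b, meant for 1 < b; elog b +oo = +oo. *)
Definition elog (R : realType) (b : R) (x : \bar R) : \bar R :=
  (lne x * ((ln b)^-1)%:E)%E.

Section Metric.
Context {R : realType} {E : normedModType R}.
Implicit Types (F G H : set E) (e : R).

(* The supremum is taken in [0, +oo], so that the empty set is at
   semi-distance 0 (and not -oo) from any H. *)
Definition semidist G H : \bar R :=
  maxe 0%E (ereal_sup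
    [set ereal_inf [set `|x - y|%:E | y in H] | x in G]).

(* Least number of open e-balls centred in G that cover G, +oo if there is no
   finite cover.  For G included in V, covering by balls of E or by balls of the
   metric subspace V is the same, so V does not appear. *)
Definition covering_number G e : \bar R :=
  ereal_inf [set (#|` U|%fset%:R)%:E | U in
    [set U : {fset E} | [set` U] `<=` G /\
                        G `<=` \bigcup_(x in [set` U]) ball x e]].

Definition fractal_dim G : \bar R :=
  limf_esup (fun e => elog e^-1 (covering_number G e)) 0^'+.

(* +oo if F has arbitrarily large finite e-separated subsets. *)
Definition packing_number F e : \bar R :=
  ereal_sup [set (#|` U|%fset%:R)%:E | U in
    [set U : {fset E} | [set` U] `<=` F /\
      forall x y, x \in U -> y \in U -> x != y -> e <= `|x - y|]].

End Metric.

Definition compact_embedding (R : realType) (E F : normedModType R)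
    (j : {linear E -> F}) : Prop :=
  [/\ injective j, continuous j &
      forall A : set E, bounded_set A -> precompact (j @` A)].

(* The time set is either [0, +oo[ or the natural numbers, seen in R. *)
Definition is_time_set (R : realType) (I : set R) : Prop :=
  I = [set t | 0 <= t] \/ I = range (fun n : nat => n%:R).

Section Semigroup.
Context {R : realType} {X : normedModType R}.
Implicit Types (I : set R) (V B G A : set X) (S : R -> X -> X).

(* S t matters only for t in I, and only on V. *)
Definition semigroup I V S : Prop :=
  [/\ forall t x, I t -> V x -> V (S t x),
      forall t s x, I t -> I s -> V x -> S t (S s x) = S (t + s) x &
      forall x, V x -> S 0 x = x].

Definition absorbing I V S B : Prop :=
  B `<=` V /\
  forall G, G `<=` V -> bounded_set G ->
    exists2 tG, I tG & forall t, I t -> tG <= t -> S t @` G `<=` B.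

Definition asymptotically_closed I V S : Prop :=
  forall (t : R) (tk : nat -> R) (xk : nat -> X) (x y : X),
    I t -> (forall k, I (tk k)) -> tk k @[k --> \oo] --> +oo ->
    (forall k, V (xk k)) -> bounded_set (range xk) ->
    V x -> V y ->
    S (tk k) (xk k) @[k --> \oo] --> x ->
    S (t + tk k) (xk k) @[k --> \oo] --> y ->
    S t x = y.

Definition global_attractor I V S A : Prop :=
  [/\ A !=set0, compact A, A `<=` V, forall t, I t -> S t @` A = A &
      forall G, G `<=` V -> bounded_set G ->
        semidist (S t @` G) A @[t --> within I +oo] --> 0%E].

Definition discrete_exponential_attractor I V S (T : R)
    (M0 : set X) : Prop :=
  [/\ M0 !=set0 /\ compact M0, M0 `<=` V, S T @` M0 `<=` M0,
      (fractal_dim M0 < +oo)%E &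
      exists2 xi : R, 0 < xi & forall G, G `<=` V -> bounded_set G ->
        ((expR (xi * t))%:E * semidist (S t @` G) M0)%E
          @[t --> within I +oo] --> 0%E].

End Semigroup.

(* The two alternatives of the smoothing property: an auxiliary space Z
   embedded into X, or an auxiliary space Y into which X embeds. *)
Variant smoothing_space (R : realType) (X : normedModType R) : Type :=
| SmoothZ (Z : normedModType R) of {linear Z -> X}
| SmoothY (Y : normedModType R) of {linear X -> Y}.

Definition smoothing_property (R : realType) (X : normedModType R)
    (a : smoothing_space X) (B : set X) (ST : X -> X) (eta kappa : R) : Prop :=
  [/\ 0 <= eta, eta < 1, 0 < kappa &
  match a with
  | SmoothZ Z j => compact_embedding j /\
      exists (C : X -> X) (M : X -> Z),
        [/\ forall x, B x -> ST x = C x + j (M x),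
            forall x y, B x -> B y -> `|C x - C y| <= eta * `|x - y| &
            forall x y, B x -> B y -> `|M x - M y| <= kappa * `|x - y|]
  | SmoothY Y j => compact_embedding j /\
      exists (C M : X -> X),
        [/\ forall x, B x -> ST x = C x + M x,
            forall x y, B x -> B y -> `|C x - C y| <= eta * `|x - y| &
            forall x y, B x -> B y -> `|M x - M y| <= kappa * `|j x - j y|]
  end].

(* The unit ball of the smaller space, measured in the norm of the larger. *)
Definition smoothing_packing (R : realType) (X : normedModType R)
    (a : smoothing_space X) (e : R) : \bar R :=
  match a with
  | SmoothZ Z j => packing_number (j @` closed_ball (0 : Z) 1) e
  | SmoothY Y j => packing_number (j @` closed_ball (0 : X) 1) e
  end.

(* Main.v *)
Require Import Defs.
From HB Require Import structures.
From mathcomp Require Import all_boot all_order all_algebra finmap.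
From mathcomp Require Import all_classical all_reals all_analysis.
From mathcomp Require Import ring lra.
Set Implicit Arguments.
Unset Strict Implicit.
Unset Printing Implicit Defensive.
Import Order.TTheory GRing.Theory Num.Theory.
Import numFieldNormedType.Exports.
Local Open Scope classical_set_scope.
Local Open Scope ring_scope.

(** A positively invariant absorbing set D is found inside B. A subset of D of
    diameter at most d splits into N = m(sigma/(2 kappa)) parts whose images
    under S(T) have diameter at most (eta + sigma) d: group the points around a
    maximal separated family, measured through M(T) or in Y. Arguing with
    diameters instead of balls avoids losing a factor 2 at each step. Hence
    K_n = S(nT) D is covered by N^n sets of diameter d (eta + sigma)^n; let w_n
    contain one point of each. M0 is the closure of E, the union of all
    S(kT) w_n. All but (n+1)^2 N^n points of E lie in K_n, which is within
    d (eta + sigma)^n of w_n; this gives compactness, the dimension bound and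
    exponential attraction.

    When B is not closed, M0 could leave B only at points of
    A = \bigcap_n closure (K_n). Asymptotic closedness makes A the global
    attractor, and S(t) A = A then forces A to lie in D. *)

(** * Separated sets and the smoothing property *)

Section Packing.
Context {R : realType}.

Lemma mem_closure_dist (E : normedModType R) (A : set E) (x : E) :
  closure A x <-> forall e, 0 < e -> exists2 y, A y & `|x - y| < e.
Proof.
split=> [xA e e0|h U /nbhs_ballP[e /= e0 eU]].
  have [y [Ay xy]] := xA _ (nbhsx_ballx x e e0).
  by exists y => //; rewrite -ball_normE in xy.
have [y Ay xy] := h _ e0; exists y; split => //.
by apply: eU; rewrite -ball_normE.
Qed.

(** By finiteness of the nets, an ultrafilter containing [A] contains a ball of every radius; it is
    therefore Cauchy and converges by completeness. *)
Lemma totally_bounded_closed_compact (E : completeNormedModType R) (A : set E) :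
  closed A ->
  (forall e, 0 < e ->
     exists s : seq E, forall x, A x -> exists2 w, w \in s & `|x - w| < e) ->
  compact A.
Proof.
move=> cA tA; rewrite compact_ultra => F FU FA.
have Fball e : 0 < e -> exists x : E, F (ball x e).
  move=> e0; have [s sA] := tA _ e0.
  have : F [set x | exists2 w, w \in s & `|x - w| < e] by apply: filterS FA.
  elim: s {sA} => [|w s IH] Fs.
    by exfalso; apply: (@filter_not_empty _ F _); apply: filterS Fs => x [].
  have [Fw|Fw] := in_ultra_setVsetC (ball w e) FU; first by exists w.
  apply: IH; apply: filterS (filterI Fs Fw) => x [[v]].
  rewrite inE => /orP[/eqP ->|vs] xv nxw; last by exists v.
  by case: nxw; rewrite -ball_normE /= distrC.
have Fcvg : cvg F by apply: cauchy_cvg; apply: cauchy_exP.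
exists (lim F); split => //=.
exact: (closed_cvg (u_ := id) _ cA FA _ Fcvg).
Qed.

(** Cover the closure by finitely many balls of radius [e / 2]: two separated points never share a
    ball, so choosing a centre is injective. *)
Lemma precompact_separated (E : normedModType R) (A : set E) (e : R) :
  precompact A -> 0 < e ->
  exists m : nat, forall U : {fset E}, [set` U] `<=` A ->
    (forall x y, x \in U -> y \in U -> x != y -> e <= `|x - y|) ->
    (#|` U| <= m)%N.
Proof.
rewrite precompactE compact_cover => cA e0.
have e20 : 0 < e / 2 by rewrite divr_gt0.
have [|D' _ AD'] := cA E setT (fun x => ball x (e / 2)) (fun x _ => ball_open x (e / 2)).
  by move=> x _; exists x => //; exact: ballxx.
exists #|` D'| => U UA Usep.
have /choice[h hP] x : exists w, A x -> w \in D' /\ `|x - w| < e / 2.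
  have [Ax|nAx] := pselect (A x); last by exists x.
  have [w wD xw] := AD' _ (subset_closure Ax).
  by exists w => _; split => //; rewrite -ball_normE /= distrC in xw.
rewrite -(@card_in_imfset imfset_key _ _ h (mem U)) /=; last first.
  move=> x y xU yU hxy; apply/eqP/negPn/negP => /(Usep _ _ xU yU).
  have [_ xh] := hP x (UA _ xU); have [_ yh] := hP y (UA _ yU).
  rewrite leNgt => /negP; apply.
  rewrite (_ : x - y = (x - h x) - (y - h x)); last by rewrite opprB addrA subrK.
  by rewrite (splitr e) (le_lt_trans (ler_normB _ _))// ltrD// hxy.
apply: fsubset_leq_card; apply/fsubsetP => z /imfsetP[x /= xU ->].
by have [] := hP x (UA _ xU).
Qed.

(** Precompactness turns the extended-real supremum into a maximum, so that counting can proceed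
    with an integer [N]. *)
Lemma packing_numberP (E : normedModType R) (A : set E) (e : R) :
  precompact A -> A !=set0 -> 0 < e ->
  exists N : nat, [/\ (0 < N)%N, (N%:R%:E <= packing_number A e)%E &
    forall U : {fset E}, [set` U] `<=` A ->
    (forall x y, x \in U -> y \in U -> x != y -> e <= `|x - y|) ->
    (#|` U| <= N)%N].
Proof.
move=> cA [a Aa] e0; have [m mP] := precompact_separated cA e0.
pose sep (U : {fset E}) := [set` U] `<=` A /\
  forall x y, x \in U -> y \in U -> x != y -> e <= `|x - y|.
pose P n := `[< exists2 U, sep U & #|` U| = n >].
have P1 : P 1%N.
  apply/asboolP; exists [fset a]%fset; last by rewrite cardfs1.
  split=> [x /=|x y]; first by rewrite inE => /eqP ->.
  by rewrite !inE => /eqP -> /eqP ->; rewrite eqxx.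
have Pm i : P i -> (i <= m)%N by move=> /asboolP[U [UA Us] <-]; exact: mP.
case: (ex_maxnP (ex_intro P 1%N P1) Pm) => N /asboolP[U [UA Us] UN] maxN.
exists N; split; first exact: maxN.
- by apply: ereal_sup_ubound; exists U => //; rewrite UN.
- by move=> W WA Ws; apply: maxN; apply/asboolP; exists W.
Qed.

(** A cover by [N] sets, encoded by colours so that successive subdivisions become arithmetic on
    colours. *)
Definition colorable (T : Type) (F : set T) (N : nat) (r : T -> T -> Prop) :=
  exists c : T -> nat, (forall x, F x -> (c x < N)%N) /\
    (forall x y, F x -> F y -> c x = c y -> r x y).

(* A maximal delta-separated family serves as the palette: each point gets the
   index of a member closer than delta. *)
Lemma separated_colorable (T : choiceType) (E : normedModType R) (f : T -> E)
    (F : set T) (delta : R) (N : nat) : 0 < delta ->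
  (forall s : seq T, (forall x, x \in s -> F x) -> uniq s ->
     (forall x y, x \in s -> y \in s -> x != y -> delta <= `|f x - f y|) ->
     (size s <= N)%N) ->
  colorable F N (fun x y => `|f x - f y| < delta *+ 2).
Proof.
move=> d0 sepN.
pose sep (s : seq T) := [/\ forall x, x \in s -> F x, uniq s &
  forall x y, x \in s -> y \in s -> x != y -> delta <= `|f x - f y|].
pose P n := `[< exists2 s, sep s & size s = n >].
have P0 : P 0%N by apply/asboolP; exists [::].
have PN i : P i -> (i <= N)%N by move=> /asboolP[s [sF us ss] <-]; exact: sepN.
case: (ex_maxnP (ex_intro P 0%N P0) PN) => n /asboolP[s [sF us ss] sn] maxn.
pose c x := find (fun u => `|f x - f u| < delta) s.
have hasF x : F x -> has (fun u => `|f x - f u| < delta) s.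
  move=> Fx; apply/negPn/negP => /hasPn far.
  have {}far u : u \in s -> delta <= `|f x - f u|.
    by move=> /far; rewrite -leNgt.
  (* A point far from all of [s] would extend [s], against maximality. *)
  suff /maxn : P n.+1 by rewrite ltnn.
  apply/asboolP; exists (x :: s); last by rewrite /= sn.
  split.
  - by move=> y; rewrite inE => /orP[/eqP ->//|/sF].
  - rewrite /= us andbT; apply/negP => /far; rewrite subrr normr0.
    by rewrite leNgt d0.
  - move=> y z; rewrite !inE => /orP[/eqP->|ys] /orP[/eqP->|zs].
    + by rewrite eqxx.
    + by move=> _; exact: far.
    + by move=> _; rewrite distrC; exact: far.
    + exact: ss.
exists c; split=> [x /hasF|x y Fx Fy cxy].
  by rewrite has_find => /leq_trans; apply; rewrite sn PN//; apply/asboolP; exists s.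
have hx := nth_find x (hasF _ Fx); have := nth_find x (hasF _ Fy).
rewrite -/(c y) -cxy /c => hy.
set u := nth _ _ _ in hx hy.
rewrite (_ : f x - f y = (f x - f u) - (f y - f u)); last first.
  by rewrite opprB addrA subrK.
by rewrite mulr2n (le_lt_trans (ler_normB _ _))// ltrD.
Qed.

Lemma continuous_linear_le (E F : normedModType R) (j : {linear E -> F}) :
  continuous j -> exists2 L, 0 < L & forall v, `|j v| <= L * `|v|.
Proof.
by move=> /linear_bounded_continuous/linear_boundedP/pinfty_ex_gt0[L L0 jL]; exists L.
Qed.

Lemma ball1_bounded (E : normedModType R) : bounded_set (closed_ball (0 : E) 1).
Proof.
rewrite closed_ballE//; exists 1; split; first exact: num_real.
by move=> M M1 x; rewrite /closed_ball_ /= sub0r normrN => /le_trans; apply; exact: ltW.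
Qed.

(** Translating by [g x0] and scaling by [d^-1] brings the values of [g] into the unit ball and
    turns separation [d * e] into [e]. Hence [N] is independent of [A], [g] and [d]. The map [g]
    serves both alternatives: it is later [M] or the identity. *)
Lemma image_ball1_packing (E F : normedModType R) (j : {linear E -> F}) (e : R) :
  compact_embedding j -> 0 < e ->
  exists N : nat, [/\ (0 < N)%N,
    (N%:R%:E <= packing_number (j @` closed_ball (0%R : E) 1%R) e)%E &
    forall (T : choiceType) (g : T -> E) (A : set T) (d : R), 0 < d ->
      (forall x y, A x -> A y -> `|g x - g y| <= d) ->
      colorable A N (fun x y => `|j (g x) - j (g y)| < (d * e) *+ 2)].
Proof.
move=> [_ _ jc] e0.
have [|N [N0 NP sepN]] := packing_numberP (jc _ (@ball1_bounded E)) _ e0.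
  by exists (j 0); exists 0 => //; rewrite closed_ballE// /closed_ball_ /= subrr normr0.
exists N; split => // T g A d d0 gA.
apply: (separated_colorable (f := j \o g)); first exact: mulr_gt0.
move=> [//|x0 s'] sA us ss; set s := x0 :: s' in sA us ss *.
have x0s : x0 \in s by rewrite mem_head. clearbody s.
pose v x := d^-1 *: (g x - g x0).
have jv x y : j (v x) - j (v y) = d^-1 *: (j (g x) - j (g y)).
  by rewrite -linearB -[in RHS]linearB -linearZ /v -scalerBr opprB addrA subrK.
have jve x y : x \in s -> y \in s -> x != y -> e <= `|j (v x) - j (v y)|.
  move=> xs ys /(ss _ _ xs ys) /= h; rewrite jv normrZ gtr0_norm ?invr_gt0//.
  by rewrite mulrC ler_pdivlMr// mulrC.
have jinj : {in s &, injective (j \o v)}.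
  move=> x y xs ys /= jxy; apply/eqP/negPn/negP => /(jve _ _ xs ys).
  by rewrite jxy subrr normr0 leNgt e0.
pose U := [fset j (v x) | x in s]%fset.
have <- : #|` U| = size s.
  by rewrite (card_in_imfset imfset_key (f := j \o v)) /= ?undup_id.
apply: sepN.
  move=> _ /imfsetP[x /= xs ->]; exists (v x) => //.
  rewrite closed_ballE// /closed_ball_ /= sub0r normrN normrZ gtr0_norm ?invr_gt0//.
  by rewrite mulrC ler_pdivrMr// mul1r gA//; apply: sA.
move=> _ _ /imfsetP[x /= xs ->] /imfsetP[y /= ys ->] jxy.
by apply: jve => //; apply: contra_neq jxy => ->.
Qed.

(** [N] is uniform in [F] and [d], which is what allows iteration. *)
Definition contracts_cover (X : normedModType R) (B : set X) (f : X -> X)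
    (q : R) (N : nat) :=
  forall F d, F `<=` B -> 0 < d -> (forall x y, F x -> F y -> `|x - y| <= d) ->
    colorable F N (fun x y => `|f x - f y| <= q * d).

(** [C] multiplies diameters by at most [eta], and within one colour [M] contributes at most
    [sigma * d]. The Lipschitz bound serves later for the invariance of closures. *)
Lemma smoothing_contracts_cover (X : normedModType R) (a : smoothing_space X)
    (B : set X) (f : X -> X) (eta kappa sigma : R) :
  smoothing_property a B f eta kappa -> 0 < sigma ->
  exists N : nat, [/\ (0 < N)%N,
    (N%:R%:E <= smoothing_packing a (sigma / (2 * kappa)))%E,
    contracts_cover B f (eta + sigma) N &
    exists2 L, 0 < L & forall x y, B x -> B y -> `|f x - f y| <= L * `|x - y|].
Proof.
move=> [eta0 eta1 k0]; set e := sigma / _ => + sigma0.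
have e0 : 0 < e by rewrite divr_gt0// mulr_gt0.
(* The 2 in [sigma / (2 * kappa)] pays for the factor between the separation and the diameter of a
   colour class. *)
have ke : kappa * e *+ 2 = sigma.
  rewrite /e -mulr_natl; field; exact: lt0r_neq0.
case: a => [Z j|Y j] [jc [C [M [fE Cl Ml]]]].
all: have [N [N0 NP colN]] := image_ball1_packing jc e0; exists N; split => //.
- move=> F d FB d0 Fd.
  have kd0 : 0 < kappa * d by rewrite mulr_gt0.
  have [|c [cN cP]] := colN _ M F _ kd0.
    move=> x y Fx Fy; rewrite (le_trans (Ml _ _ _ _)) ?ler_pM2l//; try exact: FB.
    exact: Fd.
  exists c; split => // x y Fx Fy /(cP _ _ Fx Fy) jM.
  have [Bx By] := (FB _ Fx, FB _ Fy).
  rewrite !fE// opprD addrACA (le_trans (ler_normD _ _))// mulrDl lerD//.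
    by rewrite (le_trans (Cl _ _ _ _))// ler_wpM2l// Fd.
  by rewrite (le_trans (ltW jM))// mulrAC -mulrnAl ke.
- have [_ /continuous_linear_le[L L0 jL] _] := jc.
  exists (eta + L * kappa) => [|x y Bx By]; first by rewrite ltr_wpDl// mulr_gt0.
  rewrite !fE// opprD addrACA (le_trans (ler_normD _ _))// mulrDl lerD//.
    exact: Cl.
  by rewrite -linearB (le_trans (jL _))// -mulrA ler_pM2l// Ml.
- move=> F d FB d0 Fd.
  have [c [cN cP]] := colN _ id F _ d0 Fd.
  exists c; split => // x y Fx Fy /(cP _ _ Fx Fy) /= jM.
  have [Bx By] := (FB _ Fx, FB _ Fy).
  rewrite !fE// opprD addrACA (le_trans (ler_normD _ _))// mulrDl lerD//.
    by rewrite (le_trans (Cl _ _ _ _))// ler_wpM2l// Fd.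
  rewrite (le_trans (Ml _ _ _ _))// -ke mulrnAl -mulrA -mulrnAr ler_pM2l//.
  by rewrite mulrC ltW.
- have [_ /continuous_linear_le[L L0 jL] _] := jc.
  exists (eta + kappa * L) => [|x y Bx By]; first by rewrite ltr_wpDl// mulr_gt0.
  rewrite !fE// opprD addrACA (le_trans (ler_normD _ _))// mulrDl lerD//.
    exact: Cl.
  by rewrite (le_trans (Ml _ _ _ _))// -linearB -mulrA ler_pM2l.
Qed.

End Packing.

(** * Fractal dimension *)

Section FractalDimension.
Context {R : realType}.

(** This is [ln (1 + y) <= y] at [y = a * x - 1]; the slope [a] can be taken as small as desired. *)
Lemma ln_le_affine (a x : R) : 0 < a -> 0 < x -> ln x <= a * x - 1 - ln a.
Proof.
move=> a0 x0; have ax0 : 0 < a * x by rewrite mulr_gt0.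
have : ln (1 + (a * x - 1)) <= a * x - 1 by apply: le_ln1Dx; lra.
by rewrite addrC subrK lnM ?posrE//; lra.
Qed.

(* With s = ln (1/e), the smallest n such that d q^n < e is about s/l, where
   l = ln (1/q), and the polynomial factor (n+1)^2 only costs a logarithm. *)
Lemma covering_exponent (l c D eps : R) : 0 < l -> 0 <= c -> 0 < eps ->
  exists2 S0, 0 < S0 & forall s, S0 < s -> exists n : nat,
    s + D < n%:R * l /\ 2 * ln n.+1%:R + n%:R * c <= (c / l + eps) * s.
Proof.
move=> l0 c0 e0; set L := c / l.
have L0 : 0 <= L by rewrite divr_ge0// ltW.
(* With this slope [2 * ln n.+1] costs [eps / 2 * s] plus constants. [C] gathers all constants, and
   the threshold on [s] makes [C] at most [eps / 2 * s]. *)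
pose a := eps * l / 4.
have a0 : 0 < a by rewrite /a; apply: divr_gt0 => //; apply: mulr_gt0.
pose D' := `|D|; have D'0 : 0 <= D' by rewrite normr_ge0.
pose C := L * (D' + l) + eps / 2 * (D' + 2 * l) + 2 * `|1 + ln a|.
have C0 : 0 <= C.
  rewrite /C !addr_ge0// ?mulr_ge0// ?normr_ge0// ?addr_ge0// ?mulr_ge0// ?ltW// invr_gt0//.
exists (2 * C / eps + 1) => [|s sS].
  by rewrite ltr_wpDl// divr_ge0// ?mulr_ge0// ltW.
have s0 : 0 < s.
  by apply: le_lt_trans sS; rewrite addr_ge0// divr_ge0// ?mulr_ge0// ltW.
have Cs : C <= eps / 2 * s.
  have : 2 * C / eps < s by lra.
  rewrite ltr_pdivrMr//; lra.
pose z := (s + D') / l.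
have z0 : 0 <= z by rewrite divr_ge0// ?addr_ge0// ltW.
have zl : z * l = s + D' by rewrite divfK// gt_eqF.
have zlt : z < (Num.truncn z).+1%:R by rewrite truncnS_gt.
have zge : (Num.truncn z)%:R <= z by rewrite truncn_le.
exists (Num.truncn z).+1; set n := (Num.truncn z).+1 in zlt *.
have nz : n%:R <= z + 1 by rewrite /n -natr1 lerD2r.
have nl : n%:R * l <= s + D' + l.
  by rewrite -zl -[X in _ + X]mul1r -mulrDl ler_wpM2r// ltW.
split.
  apply: (@le_lt_trans _ _ (z * l)); last by rewrite ltr_pM2r.
  by rewrite zl lerD2l ler_norm.
have nc : n%:R * c <= L * (s + D' + l).
  have -> : n%:R * c = L * (n%:R * l) by rewrite /L; field; exact: lt0r_neq0.
  exact: ler_wpM2l.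
have lnn : ln n.+1%:R <= a * n.+1%:R - 1 - ln a by apply: ln_le_affine.
have an : a * n.+1%:R <= eps / 4 * (s + D' + 2 * l).
  have -> : a * n.+1%:R = eps / 4 * (n%:R * l + l) by rewrite /a -natr1; ring.
  have e40 : 0 <= eps / 4 by lra.
  by apply: ler_wpM2l => //; lra.
have := ler_norm (- (1 + ln a)); rewrite normrN => abs_a.
apply: (@le_trans _ _ ((L + eps / 2) * s + C)); last by lra.
rewrite /C; lra.
Qed.

Context {E : normedModType R}.
Implicit Type M : set E.

Lemma covering_number_ge0 M (e : R) : (0 <= covering_number M e)%E.
Proof. by apply: le_ereal_inf_tmp => _ [U _ <-]; rewrite lee_fin. Qed.

Lemma covering_number_le_size M (e : R) (s : seq E) :
  (forall x, x \in s -> M x) ->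
  (forall x, M x -> exists2 w, w \in s & `|x - w| < e) ->
  (covering_number M e <= (size s)%:R%:E)%E.
Proof.
move=> sM Ms; apply: ge_ereal_inf.
exists (#|` [fset x in s]%fset|%:R%:E); last first.
  by rewrite lee_fin ler_nat card_fseq size_undup.
exists [fset x in s]%fset => //; split => [x /=|x /Ms[w ws xw]].
  by rewrite inE => /sM.
exists w; first by rewrite /= inE.
by rewrite -ball_normE /= distrC.
Qed.

(** Take logarithms of [(n+1)^2 N^n], with [n] supplied by [covering_exponent], and divide by
    [ln e^-1]: up to [eps] this is at most [ln N / - ln q]. *)
Lemma fractal_dim_le M (d q : R) (N : nat) : 0 < d -> 0 < q -> q < 1 ->
  (0 < N)%N ->
  (forall n e, d * q ^+ n < e ->
     (covering_number M e <= (n.+1 ^ 2 * N ^ n)%N%:R%:E)%E) ->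
  (fractal_dim M <= elog q^-1 N%:R%:E)%E.
Proof.
move=> d0 q0 q1 N0 covM.
have l0 : 0 < - ln q by rewrite oppr_gt0 ln_lt0// q0 q1.
have N0R : 0 < N%:R :> R by rewrite ltr0n.
have lnN : 0 <= ln (N%:R : R) by rewrite ln_ge0// ler1n.
rewrite /elog lne_EFin// lnV ?posrE// -EFinM.
apply/lee_addgt0Pr => eps eps0.
have [S0 S00 S0P] := covering_exponent (ln d) l0 lnN eps0.
(* The upper limit is an infimum over neighbourhoods; the one used is where [ln e^-1] exceeds
   [S0]. *)
apply: ge_ereal_inf; eexists.
  exists [set e | 0 < e < expR (- S0)]; last by [].
  near=> e; apply/andP; split; near: e.
    exact: nbhs_right_gt.
  by apply: nbhs_right_lt; exact: expR_gt0.
apply: ge_ereal_sup => _ [e /andP[e0 eS] <-].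
have sS : S0 < ln e^-1.
  by rewrite lnV ?posrE// ltrNr -[X in _ < X]expRK ltr_ln ?posrE// expR_gt0.
have [n [sn nP]] := S0P _ sS.
have s0 : 0 < ln e^-1 by apply: lt_trans sS.
have /covM cov : d * q ^+ n < e.
  rewrite -ltr_ln ?posrE// ?mulr_gt0// ?exprn_gt0//.
  rewrite lnM ?posrE// ?exprn_gt0// lnXn// -mulr_natl.
  by move: sn; rewrite lnV ?posrE//; lra.
have pos : 0 < (n.+1 ^ 2 * N ^ n)%N%:R :> R.
  by rewrite ltr0n muln_gt0 expn_gt0/= expn_gt0 N0.
rewrite /elog -EFinD; apply: (@le_trans _ _ ((ln (n.+1 ^ 2 * N ^ n)%N%:R)%:E * (ln e^-1)^-1%:E)%E).
  apply: lee_wpmul2r; first by rewrite lee_fin invr_ge0 ltW.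
  rewrite -lne_EFin// lee_lne// in_itv /= leey andbT ?covering_number_ge0//.
rewrite -EFinM lee_fin ler_pdivrMr//.
rewrite natrM !natrX lnM ?posrE ?exprn_gt0// !lnXn//.
by rewrite -[_ *+ 2]mulr_natl -[_ *+ n]mulr_natl.
Unshelve. all: by end_near. Qed.

End FractalDimension.

(** * Iterated covers and the finite nets extracted from them *)

Section IteratedCover.
Context {R : realType} {X : normedModType R}.
Implicit Types (B K : set X) (f : X -> X).

(** Each of the [m] classes of [K] is split into [N] by [f], so a class of the image is a pair of
    colours. *)
Lemma colorable_image B f (q d : R) (N m : nat) K : contracts_cover B f q N ->
  0 < d -> K `<=` B -> colorable K m (fun x y => `|x - y| <= d) ->
  colorable (f @` K) (m * N) (fun x y => `|x - y| <= q * d).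
Proof.
move=> fB d0 KB [c [cm cd]].
have /choice[b bP] i : exists b, (forall x, K x -> c x = i -> (b x < N)%N) /\
    forall x y, K x -> K y -> c x = i -> c y = i -> b x = b y ->
      `|f x - f y| <= q * d.
  have [||b [bN bd]] := fB [set x | K x /\ c x = i] d _ d0.
  - by move=> x [/KB Bx _].
  - by move=> x y [Kx <-] [Ky yx]; apply: cd.
  - by exists b; split => [x Kx xi|x y Kx Ky xi yi]; [exact: bN|exact: bd].
(* A point of the image may have several preimages; fixing one makes its colour well defined. *)
have /choice[g gP] y : exists x, (f @` K) y -> K x /\ f x = y.
  have [[x Kx xy]|ny] := pselect ((f @` K) y); first by exists x.
  by exists y.
(* The pair is written in base [N]: since [b] stays below [N], division recovers the first
   colour. *)
exists (fun y => c (g y) * N + b (c (g y)) (g y))%N; split=> [y /gP[Kg _]|].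
  have bN := (bP (c (g y))).1 _ Kg erefl.
  apply: (@leq_trans ((c (g y)).+1 * N)); last by rewrite leq_mul2r cm ?orbT.
  by rewrite mulSn addnC ltn_add2r.
move=> y z /gP[Kgy fgy] /gP[Kgz fgz].
have bNy := (bP (c (g y))).1 _ Kgy erefl.
have bNz := (bP (c (g z))).1 _ Kgz erefl.
have N0 : (0 < N)%N by apply: leq_ltn_trans bNy.
move=> e; have ce : c (g y) = c (g z).
  by move/(congr1 (divn^~ N)): e; rewrite !divnMDl// !divn_small// !addn0.
move: e; rewrite ce => /addnI be.
by rewrite -fgy -fgz; apply: (bP (c (g z))).2.
Qed.

Lemma colorable_iter B f (q d : R) (N : nat) (K : nat -> set X) :
  contracts_cover B f q N -> 0 < d -> 0 < q -> (forall n, K n `<=` B) ->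
  (forall n, K n.+1 `<=` f @` K n) ->
  (forall x y, K 0%N x -> K 0%N y -> `|x - y| <= d) ->
  forall n, colorable (K n) (N ^ n) (fun x y => `|x - y| <= d * q ^+ n).
Proof.
move=> fB d0 q0 KB KS K0; elim=> [|n IH].
  by exists (fun=> 0%N); split => // x y Kx Ky _; rewrite mulr1 K0.
have dq0 : 0 < d * q ^+ n by rewrite mulr_gt0// exprn_gt0.
have [c [cN cd]] := colorable_image fB dq0 (KB n) IH.
exists c; split => [x /KS/cN|x y /KS Kx /KS Ky /(cd _ _ Kx Ky)].
  by rewrite expnSr.
by rewrite exprS mulrCA.
Qed.

Lemma colorable_net K (m : nat) (d : R) :
  colorable K m (fun x y => `|x - y| <= d) ->
  exists s : seq X, [/\ (size s <= m)%N, forall x, x \in s -> K x &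
    forall x, K x -> exists2 w, w \in s & `|x - w| <= d].
Proof.
move=> [c [cm cd]]; have [K0|/nonemptyPn K0] := pselect (K !=set0); last first.
  by exists [::]; split => // x; rewrite K0.
case: K0 => x0 Kx0.
pose used i := `[< exists2 x, K x & c x = i >].
have /choice[h hP] i : exists x, used i -> K x /\ c x = i.
  have [[x Kx xi]|nu] := pselect (exists2 x, K x & c x = i); first by exists x.
  by exists x0 => /asboolP.
exists [seq h i | i <- iota 0 m & used i]; split.
- by rewrite size_map size_filter (leq_trans (count_size _ _))// size_iota.
- by move=> y /mapP[i]; rewrite mem_filter => /andP[/hP[Kh _] _ ->].
- move=> x Kx; have ux : used (c x) by apply/asboolP; exists x.
  have [Kh ch] := hP _ ux.
  exists (h (c x)); last by apply: cd.
  by apply: map_f; rewrite mem_filter ux mem_iota /= cm.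
Qed.

End IteratedCover.

(** * The closure of the net points *)

Section Core.
Context {R : realType} {X : completeNormedModType R}.

Lemma geometric_lt (d q e : R) : 0 < d -> 0 < q -> q < 1 -> 0 < e ->
  exists n : nat, forall k, (n <= k)%N -> d * q ^+ k < e.
Proof.
move=> d0 q0 q1 e0.
have : geometric d q @ \oo --> (0 : R) by apply: cvg_geometric; rewrite gtr0_norm.
move=> /cvgrPdist_lt/(_ _ e0)[n _ nP]; exists n => k /nP /=.
by rewrite sub0r normrN ger0_norm// mulr_ge0 ?exprn_ge0 ?ltW.
Qed.

(** Setting isolated from the dynamics: [K n] will be [S(nT) D], [E] the union of the orbits of the
    nets, and [s n] a finite part of [E] that contains a net of [K n] and every point of [E] outside
    [K n]. *)
Context (K : nat -> set X) (E : set X) (s : nat -> seq X) (d q : R) (N : nat).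
Hypotheses (d_gt0 : 0 < d) (q_gt0 : 0 < q) (q_lt1 : q < 1) (N_gt0 : (0 < N)%N).
Hypothesis K_nonincr : forall m n, (m <= n)%N -> K n `<=` K m.
Hypothesis size_s : forall n, (size (s n) <= n.+1 ^ 2 * N ^ n)%N.
Hypothesis s_sub : forall n x, x \in s n -> E x.
Hypothesis K_net :
  forall n x, K n x -> exists2 w, w \in s n & `|x - w| <= d * q ^+ n.
Hypothesis E_tail : forall n x, E x -> x \in s n \/ K n x.

(** The slack [e - d q^n] is spent on approximating [x] by a point of [E], which is in [s n] or,
    lying in [K n], within [d q^n] of it. *)
Lemma closure_core_net n e x : d * q ^+ n < e -> closure E x ->
  exists2 w, w \in s n & `|x - w| < e.
Proof.
rewrite -subr_gt0 => ne /mem_closure_dist/(_ _ ne)[y Ey xy].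
have dq0 : 0 <= d * q ^+ n by rewrite mulr_ge0 ?exprn_ge0 ?ltW.
have [ys|/K_net[w ws yw]] := E_tail n Ey.
  by exists y => //; rewrite (lt_le_trans xy)// gerBl.
by exists w => //; rewrite (le_lt_trans (ler_distD y _ _))// -ltrBrDr (lt_le_trans xy)// lerB.
Qed.

Lemma compact_closure_core : compact (closure E).
Proof.
apply: totally_bounded_closed_compact => [|e e0]; first exact: closed_closure.
have [n /(_ n (leqnn n)) ne] := geometric_lt d_gt0 q_gt0 q_lt1 e0.
by exists (s n) => x; exact: closure_core_net.
Qed.

Lemma fractal_dim_closure_core :
  (fractal_dim (closure E) <= elog q^-1 N%:R%:E)%E.
Proof.
apply: (fractal_dim_le d_gt0) => // n e ne.
apply: (@le_trans _ _ (size (s n))%:R%:E); last by rewrite lee_fin ler_nat.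
apply: covering_number_le_size => [x /s_sub|x]; first exact: subset_closure.
exact: closure_core_net.
Qed.

(** For the decreasing sets [S(nT) D] this is the usual omega-limit set of [D]. *)
Definition omega_limit : set X := \bigcap_n closure (K n).

Lemma omega_limit_sub_core : omega_limit `<=` closure E.
Proof.
move=> x Kx; apply/mem_closure_dist => e e0.
have e20 : 0 < e / 2 by lra.
have [n /(_ n (leqnn n)) ne] := geometric_lt d_gt0 q_gt0 q_lt1 e20.
have /mem_closure_dist/(_ _ e20)[y Ky xy] := Kx n I.
have [w ws yw] := K_net Ky; exists w; first exact: s_sub ws.
by rewrite (splitr e) (le_lt_trans (ler_distD y _ _))// ltrD// (le_lt_trans yw).
Qed.

(** Reduces locating [closure E] inside a set that may not be closed to locating the omega-limit set
    there. *)
Lemma closure_core_sub : closure E `<=` E `|` omega_limit.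
Proof.
move=> x Ex; have [|nEx] := pselect (E x); [by left|right => n _].
apply/mem_closure_dist => e e0.
(* s n is finite and misses x, so it stays away from x *)
have [r r0 rs] : exists2 r, 0 < r & forall w, w \in s n -> r <= `|x - w|.
  have : forall w, w \in s n -> w != x.
    by move=> w /s_sub Ew; apply: contra_notN nEx => /eqP <-.
  elim: (s n) => [|w l IH] nx; first by exists 1.
  have [v vl|r r0 rl] := IH; first by apply: nx; rewrite inE vl orbT.
  exists (Num.min r `|x - w|) => [|v].
    by rewrite lt_min r0 normr_gt0 subr_eq0 eq_sym nx// mem_head.
  by rewrite inE ge_min => /orP[/eqP ->|/rl ->//]; rewrite lexx orbT.
have er0 : 0 < Num.min e r by rewrite lt_min e0.
have /mem_closure_dist/(_ _ er0)[y Ey] := Ex.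
rewrite lt_min => /andP[xye xyr]; exists y => //.
by have [/rs|//] := E_tail n Ey; rewrite leNgt xyr.
Qed.

(** Each [u k] is within [d q^k] of a point [p k] of [E], and [p] clusters because [closure E] is
    compact. The subsequence comes with an explicit rate, ready for asymptotic closedness. *)
Lemma omega_limit_cluster (u : nat -> X) : (forall n, K n (u n)) ->
  exists2 x, omega_limit x & exists g : nat -> nat,
    forall k, (k <= g k)%N /\ `|u (g k) - x| < k.+1%:R^-1.
Proof.
move=> Ku; have /choice[p pP] k : exists w, E w /\ `|u k - w| <= d * q ^+ k.
  by have [w ws uw] := K_net (Ku k); exists w; split => //; exact: s_sub ws.
have [|x [_ xp]] := compact_closure_core (fmap_proper_filter p eventually_filter).
  by exists 0%N => // k _; apply: subset_closure; exact: (pP k).1.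
have near_x e n : 0 < e -> exists2 k, (n <= k)%N & `|u k - x| < e.
  move=> e0; have e20 : 0 < e / 2 by lra.
  have [m mP] := geometric_lt d_gt0 q_gt0 q_lt1 e20.
  have [|_ [[k /= mnk <-] xk]] := xp (p @` [set k | (maxn m n <= k)%N]) _ _ (nbhsx_ballx x _ e20).
    by exists (maxn m n) => // k /= mnk; exists k.
  rewrite geq_max in mnk; have /andP[mk nk] := mnk.
  exists k => //; rewrite (splitr e) (le_lt_trans (ler_distD (p k) _ _))// ltrD//.
    exact: le_lt_trans (pP k).2 (mP _ mk).
  by move: xk; rewrite -ball_normE /= distrC.
exists x.
  move=> n _; apply/mem_closure_dist => e /(near_x _ n)[k nk kx].
  by exists (u k); [exact: K_nonincr nk _ (Ku k)|rewrite distrC].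
suff /choice[g gP] k : exists j, (k <= j)%N /\ `|u j - x| < k.+1%:R^-1 by exists g.
by have [|j kj jx] := near_x k.+1%:R^-1 k; [rewrite invr_gt0 ltr0n|exists j].
Qed.

End Core.

(** * Semigroups *)

Section TimeSet.
Context {R : realType} (I : set R).

(** All later reasoning on time goes through these four facts, common to both time sets. *)
Lemma time_setP : is_time_set I ->
  [/\ I 0, forall t, I t -> 0 <= t, forall s t, I s -> I t -> I (s + t) &
      forall s t, I s -> I t -> s <= t -> I (t - s)].
Proof.
move=> [->|->]; split => //=.
- by move=> s t s0 t0; rewrite addr_ge0.
- by move=> s t _ _; rewrite subr_ge0.
- by exists 0%N.
- by move=> _ [n _ <-]; rewrite ler0n.
- by move=> _ _ [m _ <-] [n _ <-]; exists (m + n)%N => //; rewrite natrD.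
- by move=> _ _ [m _ <-] [n _ <-]; rewrite ler_nat => mn; exists (n - m)%N; rewrite ?natrB.
Qed.

Lemma cvg0_within_pinfty (f : R -> \bar R) : (forall t, 0%E <= f t)%E ->
  (forall e, 0 < e -> exists a, forall t, I t -> a <= t -> (f t <= e%:E)%E) ->
  f t @[t --> within I +oo] --> 0%E.
Proof.
move=> f0 fe; apply/fine_cvgP; split.
  have [a aP] := fe 1 ltr01; exists a; split; first exact: num_real.
  move=> t /ltW/aP h It; rewrite ge0_fin_numE//.
  by rewrite (le_lt_trans (h It))// ltry.
apply/cvgrPdist_le => e e0; have [a aP] := fe e e0.
exists a; split; first exact: num_real.
move=> t /ltW/aP h It /=; rewrite sub0r normrN ger0_norm; last exact: fine_ge0.
rewrite -lee_fin fineK ?h// ge0_fin_numE//.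
by rewrite (le_lt_trans (h It))// ltry.
Qed.

End TimeSet.

Section SemiDistance.
Context {R : realType} {E : normedModType R}.
Implicit Types G H : set E.

Lemma semidist_ge0 G H : (0 <= semidist G H)%E.
Proof. by rewrite /semidist le_max lexx. Qed.

Lemma semidist_le G H (r : R) : 0 <= r ->
  (forall x, G x -> exists2 y, H y & `|x - y| <= r) ->
  (semidist G H <= r%:E)%E.
Proof.
move=> r0 GH; rewrite /semidist ge_max lee_fin r0 /=.
apply: ge_ereal_sup => _ [x /GH[y Hy xy] <-]; apply: ge_ereal_inf.
by exists `|x - y|%:E; [exists y|rewrite lee_fin].
Qed.

Lemma bounded_subset G H : G `<=` H -> bounded_set H -> bounded_set G.
Proof.
by move=> GH [M [Mr MH]]; exists M; split=> // x /MH Hx y /GH; exact: Hx.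
Qed.

End SemiDistance.

(** [D] is the union of [S(t) B] over the late times [t], those from which on [B] is mapped into
    itself. Adding a time to a late time gives a late time, whence invariance. A bounded set first
    enters [B], then waits one late time [tB]. *)
Lemma absorbing_invariant (R : realType) (X : normedModType R) (V : set X)
    (I : set R) (S : R -> X -> X) (B : set X) :
  is_time_set I -> semigroup I V S -> bounded_set B -> absorbing I V S B ->
  exists D : set X, [/\ D `<=` B, absorbing I V S D &
    forall t, I t -> S t @` D `<=` D].
Proof.
move=> It [SV SD S0] bB [BV Babs]; have [I0 Ige0 ID IB] := time_setP It.
pose late t := I t /\ forall r, I r -> t <= r -> S r @` B `<=` B.
pose D := [set x | exists2 t, late t & (S t @` B) x].
have DB : D `<=` B by move=> x [t [It' tB]]; exact: tB.
exists D; split => //.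
  split=> [x /DB /BV//|G GV bG].
  have [tG ItG GB] := Babs _ GV bG; have [tB ItB BB] := Babs _ BV bB.
  exists (tG + tB); first exact: ID.
  move=> t It' tt _ [x Gx <-].
  have tB0 := Ige0 _ ItB; have tG0 := Ige0 _ ItG.
  have It1 : I (t - tB) by apply: IB => //; lra.
  exists tB => //; exists (S (t - tB) x).
    by apply: GB It1 _ _ _; [lra|exists x].
  by rewrite SD ?(addrC tB) ?subrK//; exact: GV.
move=> t It' _ [_ [r [Ir rB] [y By <-]] <-]; exists (t + r); last first.
  by exists y => //; rewrite SD//; exact: BV.
split=> [|u Iu tu]; first exact: ID.
by apply: rB => //; have := Ige0 _ It'; lra.
Qed.

(** * Dynamics inside the invariant absorbing set *)

Section Semigroup.
Context {R : realType} {X : completeNormedModType R} (V : set X) (I : set R)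
  (S : R -> X -> X) (T : R) (D : set X).
Hypotheses (I_time : is_time_set I) (S_semigroup : semigroup I V S).
Hypotheses (T_time : I T) (T_gt0 : 0 < T).
Hypotheses (D_absorbing : absorbing I V S D)
  (D_invariant : forall t, I t -> S t @` D `<=` D).

Definition stage n : set X := S (n%:R * T) @` D.

Let I0 : I 0. Proof. by have [] := time_setP I_time. Qed.
Let ID s t : I s -> I t -> I (s + t).
Proof. by have [_ _ + _] := time_setP I_time; apply. Qed.
Let IB s t : I s -> I t -> s <= t -> I (t - s).
Proof. by have [_ _ _] := time_setP I_time; apply. Qed.
Let Ige0 t : I t -> 0 <= t.
Proof. by have [_ + _ _] := time_setP I_time; apply. Qed.
Let DV : D `<=` V. Proof. by case: D_absorbing. Qed.
Let SSD s t x : I s -> I t -> V x -> S s (S t x) = S (s + t) x.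
Proof. by have [_ + _] := S_semigroup; apply. Qed.
Let SDD t x : I t -> D x -> D (S t x).
Proof. by move=> It Dx; apply: (D_invariant It); exists x. Qed.
Let InT n : I (n%:R * T).
Proof.
elim: n => [|n IH]; first by rewrite mul0r.
by rewrite -natr1 mulrDl mul1r; exact: ID.
Qed.

Lemma stage_sub n : stage n `<=` D.
Proof. exact: D_invariant. Qed.

(** Splitting [S(t) = S(nT) S(t - nT)] reduces arbitrary times to multiples of [T], by invariance of
    [D]. *)
Lemma late_stage n t x : I t -> n%:R * T <= t -> D x -> stage n (S t x).
Proof.
move=> It nt Dx; have It' := IB (InT n) It nt.
exists (S (t - n%:R * T) x); first exact: SDD.
by rewrite SSD ?(addrC (n%:R * T)) ?subrK//; exact: DV.
Qed.

Lemma stage_nonincr m n : (m <= n)%N -> stage n `<=` stage m.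
Proof.
by move=> mn _ [x Dx <-]; apply: late_stage => //; rewrite ler_pM2r// ler_nat.
Qed.

Lemma stageS n : stage n.+1 `<=` S T @` stage n.
Proof.
move=> _ [x Dx <-]; exists (S (n%:R * T) x); first by exists x.
by rewrite SSD -?[n.+1%:R]natr1 ?mulrDl ?mul1r ?(addrC T)//; exact: DV.
Qed.

Lemma absorbed_stage G : G `<=` V -> bounded_set G ->
  exists2 a, I a & forall n t, I t -> a + n%:R * T <= t -> S t @` G `<=` stage n.
Proof.
move=> GV bG; have [tG ItG GD] := D_absorbing.2 G GV bG; exists tG => // m t It tt.
move=> _ [x Gx <-]; have tG0 := Ige0 ItG; have m0 := Ige0 (InT m).
have It1 : I (t - m%:R * T) by apply: IB => //; lra.
exists (S (t - m%:R * T) x); first by apply: GD It1 _ _ _; [lra|exists x].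
by rewrite SSD ?(addrC (m%:R * T)) ?subrK//; exact: GV.
Qed.

(** Each pair [j, k <= n] contributes at most [N^n] points [S(kT) x] with [x] in [w j], whence the
    square. For any other pair such points lie in [S((k+j)T) D] with [k + j > n], hence in
    [stage n]. *)
Lemma stage_core (d q : R) (N : nat) : (0 < N)%N ->
  (forall n, colorable (stage n) (N ^ n) (fun x y => `|x - y| <= d * q ^+ n)) ->
  exists (E : set X) (s : nat -> seq X), [/\ E `<=` D, S T @` E `<=` E,
    forall n, (size (s n) <= n.+1 ^ 2 * N ^ n)%N,
    forall n x, x \in s n -> E x &
    (forall n x, stage n x -> exists2 w, w \in s n & `|x - w| <= d * q ^+ n) /\
    (forall n x, E x -> x \in s n \/ stage n x)].
Proof.
move=> N0 /(fun h n => colorable_net (h n))/choice[w wP].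
have wD j x : x \in w j -> D x.
  by have [_ wK _] := wP j => /wK /stage_sub.
pose E := [set y | exists j k x, x \in w j /\ y = S (k%:R * T) x].
pose ws n := flatten [seq w j | j <- iota 0 n.+1].
have mem_ws n x : x \in ws n <-> exists2 j, (j <= n)%N & x \in w j.
  split=> [/flattenP[_ /mapP[j + ->] xw]|[j jn xw]].
    by rewrite mem_iota => jn; exists j.
  by apply/flattenP; exists (w j) => //; apply: map_f; rewrite mem_iota.
pose s n := [seq S (k%:R * T) x | k <- iota 0 n.+1, x <- ws n].
exists E, s; split.
- by move=> _ [j [k [x [xw ->]]]]; apply: SDD => //; exact: wD xw.
- move=> _ [_ [j [k [x [xw ->]]]] <-]; exists j, k.+1, x; split => //.
  rewrite SSD -?[k.+1%:R]natr1 ?mulrDl ?mul1r ?(addrC T)//.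
  by apply: DV; exact: wD xw.
- move=> n; rewrite size_allpairs size_iota expnS expn1 -mulnA leq_pmul2l// /ws.
  have : forall j, j \in iota 0 n.+1 -> (size (w j) <= N ^ n)%N.
    move=> j; rewrite mem_iota /= ltnS => jn; have [wj _ _] := wP j.
    by rewrite (leq_trans wj)// leq_pexp2l.
  rewrite -[X in (_ <= X * _)%N](size_iota 0).
  elim: (iota 0 n.+1) => //= j l IH wl; rewrite size_cat mulSn leq_add ?wl ?mem_head//.
  by apply: IH => i il; rewrite wl// inE il orbT.
- by move=> n y /allpairsP[[k x] /= [_ /mem_ws[j _ xw] ->]]; exists j, k, x.
split=> [n x Kx|n _ [j [k [x [xw ->]]]]].
  have [_ wK /(_ _ Kx)[v vw xv]] := wP n; exists v => //.
  (* The net [w n] itself sits in [s n] with [k = 0]. *)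
  apply/allpairsP; exists (0%N, v); split => //=; first by apply/mem_ws; exists n.
  have [_ _ S0] := S_semigroup.
  by rewrite mul0r S0//; apply: DV; exact: wD vw.
have [jkn|] := boolP ((j <= n) && (k <= n))%N.
  have [jn kn] := andP jkn; left; apply/allpairsP; exists (k, x); split => //.
    by rewrite mem_iota.
  by apply/mem_ws; exists j.
move=> jkn; right; have [_ /(_ _ xw)[z Dz <-] _] := wP j.
rewrite SSD//; last exact: DV.
apply: late_stage => //; first exact: ID.
rewrite -mulrDl ler_pM2r// -natrD ler_nat.
by move: jkn; rewrite negb_and -!ltnNge => /orP[] /ltnW /leq_trans; apply; rewrite ?leq_addl ?leq_addr.
Qed.

Lemma exponential_attraction (M : set X) (d q : R) :
  0 < d -> 0 < q -> q < 1 ->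
  (forall n x, stage n x -> exists2 y, M y & `|x - y| <= d * q ^+ n) ->
  exists2 xi : R, 0 < xi & forall G, G `<=` V -> bounded_set G ->
    ((expR (xi * t))%:E * semidist (S t @` G) M)%E
      @[t --> within I +oo] --> 0%E.
Proof.
move=> d0 q0 q1 stageM.
have lq : ln q < 0 by rewrite ln_lt0// q0 q1.
(* Half of the available rate: [q^n] is [expR (- 2 xi n T)], so a decay of order [expR (- xi t)]
   survives the multiplication by [expR (xi t)]. *)
pose xi := - ln q / (2 * T).
have xi0 : 0 < xi by rewrite divr_gt0// ?mulr_gt0// oppr_gt0.
have lnq : ln q = - (2 * xi * T) by rewrite /xi; field; exact: lt0r_neq0.
exists xi => // G GV bG.
have [a Ia aP] := absorbed_stage GV bG.
apply: cvg0_within_pinfty => [t|e e0].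
  by rewrite mule_ge0 ?semidist_ge0// lee_fin expR_ge0.
(* As [n T > t - a - T], the product is at most [d expR (2 xi (a + T) - xi t)]; the second bound
   makes this at most [e], the first makes [t - a] nonnegative. *)
exists (Num.max a ((2 * xi * (a + T) - ln (e / d)) / xi)) => t It.
rewrite ge_max => /andP[at' tt].
pose z := (t - a) / T.
have z0 : 0 <= z by rewrite divr_ge0 ?subr_ge0// ltW.
have zT : z * T = t - a by rewrite divfK// gt_eqF.
have zlt : z < (Num.truncn z).+1%:R by rewrite truncnS_gt.
have zge : (Num.truncn z)%:R <= z by rewrite truncn_le.
set n := Num.truncn z in zlt zge *.
have nT : n%:R * T <= t - a by rewrite -zT ler_pM2r.
have nT1 : t - a < n%:R * T + T.
  by rewrite -zT -[X in _ + X]mul1r -mulrDl natr1 ltr_pM2r.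
have dq0 : 0 <= d * q ^+ n by rewrite mulr_ge0 ?exprn_ge0 ?ltW.
have sd : (semidist (S t @` G) M <= (d * q ^+ n)%:E)%E.
  apply: semidist_le => // x Gx; apply: stageM; apply: aP Gx => //; lra.
apply: (@le_trans _ _ ((expR (xi * t))%:E * (d * q ^+ n)%:E)%E).
  by apply: lee_wpmul2l => //; rewrite lee_fin expR_ge0.
rewrite -EFinM lee_fin mulrCA -[q]lnK ?posrE// -expRM_natl -expRD.
rewrite mulrC -ler_pdivlMr// -ler_ln ?posrE ?expR_gt0 ?divr_gt0// expRK.
rewrite lnq; move: tt; rewrite ler_pdivrMr// => tt.
have : xi * (t - a) <= xi * (n%:R * T + T) by rewrite ler_pM2l// ltW.
lra.
Qed.

(** * The omega-limit set as global attractor *)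

Section Attractor.
Context (E : set X) (s : nat -> seq X) (d q : R) (N : nat).
Hypotheses (d_gt0 : 0 < d) (q_gt0 : 0 < q) (q_lt1 : q < 1).
Hypothesis s_sub : forall n x, x \in s n -> E x.
Hypothesis stage_net :
  forall n x, stage n x -> exists2 w, w \in s n & `|x - w| <= d * q ^+ n.
Hypothesis E_tail : forall n x, E x -> x \in s n \/ stage n x.
Hypotheses (V_closed : closed V) (V_nonempty : V !=set0).
Hypothesis D_bounded : bounded_set D.
Hypothesis S_closed : asymptotically_closed I V S.

Let A := omega_limit stage.

Let cluster_stage := omega_limit_cluster d_gt0 q_gt0 q_lt1 stage_nonincr s_sub
  stage_net E_tail.

Lemma omega_limit_subV : A `<=` V.
Proof.
move=> x /(_ 0%N Logic.I); rewrite (closure_id V).1// => h.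
by apply: closure_subset h; apply: subset_trans DV; exact: stage_sub.
Qed.

Lemma absorbing_nonempty : D !=set0.
Proof.
have [v Vv] := V_nonempty.
have [||t It tD] := D_absorbing.2 [set v] _ _; first by move=> _ ->.
  by exists `|v|; split => [|M vM _ ->]; [exact: num_real|exact: ltW].
by exists (S t v); apply: (tD t It (lexx _)); exists v.
Qed.

(* Asymptotic closedness, applied along a subsequence with S (r k) (z k) --> x
   and S t (S (r k) (z k)) --> y. *)
Lemma asymptotically_closed_subseq t (r : nat -> R) (z : nat -> X)
    (g : nat -> nat) x y : I t -> (forall k, I (r k) /\ k%:R * T <= r k) ->
  (forall k, D (z k)) -> A x -> A y -> (forall k, (k <= g k)%N) ->
  (forall k, `|S (r (g k)) (z (g k)) - x| < k.+1%:R^-1) ->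
  (forall k, `|S (t + r (g k)) (z (g k)) - y| < k.+1%:R^-1) ->
  S t x = y.
Proof.
move=> It rP Dz Ax Ay gk gx gy.
have cvg_inv (u : nat -> X) (l : X) :
    (forall k, `|u k - l| < k.+1%:R^-1) -> u @ \oo --> l.
  move=> ul; apply/cvgrPdist_lt => e e0.
  have /cvgrPdist_lt/(_ _ e0)[n _ nP] := @cvg_harmonic R.
  exists n => // k /nP /=; rewrite sub0r normrN distrC => h.
  by rewrite (lt_trans (ul k))// (le_lt_trans (ler_norm _) h).
apply: (S_closed (tk := r \o g) (xk := z \o g) It).
- by move=> k; have [] := rP (g k).
- apply/cvgryPge => M; exists (Num.truncn (`|M| / T)).+1 => // k /= Mk.
  apply: le_trans (rP (g k)).2; rewrite -ler_pdivrMr//.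
  apply: (@le_trans _ _ (`|M| / T)); first by rewrite ler_pM2r ?invr_gt0// ler_norm.
  apply: ltW; apply: (lt_le_trans (truncnS_gt _)).
  by rewrite ler_nat; exact: leq_trans Mk (gk k).
- by move=> k; apply: DV; exact: Dz.
- apply: (bounded_subset _ D_bounded) => _ [k _ <-]; exact: Dz.
- exact: omega_limit_subV.
- exact: omega_limit_subV.
- exact: cvg_inv.
- exact: cvg_inv.
Qed.

Lemma stage_approx n x : A x ->
  exists2 z, D z & `|S (n%:R * T) z - x| < n.+1%:R^-1.
Proof.
move=> /(_ n Logic.I)/mem_closure_dist/(_ n.+1%:R^-1)[].
  by rewrite invr_gt0 ltr0n.
by move=> _ [z Dz <-] xz; exists z => //; rewrite distrC.
Qed.

(** Asymptotic closedness stands in for continuity of [S(t)]. Given [x] in [A], [S(t) x] is a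
    cluster point of the images of a sequence approximating [x]; given [y], a preimage is a cluster
    point of an approximating sequence taken [t] earlier. *)
Lemma omega_limit_invariant t : I t -> S t @` A = A.
Proof.
move=> It; apply/seteqP; split=> [_ [x Ax <-]|y Ay].
  have /choice[z zP] k : exists z, D z /\ `|S (k%:R * T) z - x| < k.+1%:R^-1.
    by have [z] := stage_approx k Ax; exists z.
  have [k|y Ay [g gP]] := cluster_stage (u := fun k => S (t + k%:R * T) (z k)).
    apply: late_stage; [exact: ID|by rewrite lerDr Ige0|exact: (zP k).1].
  rewrite (@asymptotically_closed_subseq t (fun k => k%:R * T) z g x y)//.
  - by move=> k; exact: (zP k).1.
  - by move=> k; exact: (gP k).1.
  - move=> k; rewrite (lt_le_trans (zP (g k)).2)// lef_pV2 ?posrE ?ltr0n//.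
    by rewrite ler_nat ltnS (gP k).1.
  - by move=> k; exact: (gP k).2.
(* The shift by [m], with [m T >= t], makes [r k] an admissible time not before [k T]. *)
pose m := (Num.truncn (t / T)).+1.
have tm : t <= m%:R * T by rewrite -ler_pdivrMr// ltW// truncnS_gt.
pose r k := (m + k)%:R * T - t.
have rk k : k%:R * T <= r k by rewrite /r natrD mulrDl; lra.
have Ir k : I (r k).
  by apply: IB => //; rewrite natrD mulrDl (le_trans tm)// lerDl Ige0.
have /choice[z zP] k : exists z, D z /\ `|S ((m + k)%:R * T) z - y| < (m + k).+1%:R^-1.
  by have [z] := stage_approx (m + k) Ay; exists z.
have [k|x Ax [g gP]] := cluster_stage (u := fun k => S (r k) (z k)).
  by apply: late_stage => //; exact: (zP k).1.
exists x => //; apply: (@asymptotically_closed_subseq t r z g x y) => //.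
- by move=> k; exact: (zP k).1.
- by move=> k; exact: (gP k).1.
- by move=> k; exact: (gP k).2.
- move=> k; rewrite /r subrKC (lt_le_trans (zP (g k)).2)//.
  rewrite lef_pV2 ?posrE ?ltr0n// ler_nat ltnS.
  by rewrite (leq_trans (gP k).1)// leq_addl.
Qed.

Lemma omega_limit_sub_closure : A `<=` closure E.
Proof. exact: omega_limit_sub_core d_gt0 q_gt0 q_lt1 s_sub stage_net. Qed.

Lemma global_attractor_omega_limit : global_attractor I V S A.
Proof.
have [z Dz] := absorbing_nonempty; split.
- have [k|x Ax _] := cluster_stage (u := fun k => S (k%:R * T) z); last by exists x.
  by exists z.
- have cE := compact_closure_core d_gt0 q_gt0 q_lt1 stage_net E_tail.
  apply: (subclosed_compact _ cE omega_limit_sub_closure).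
  by apply: closed_bigI => n _; exact: closed_closure.
- exact: omega_limit_subV.
- exact: omega_limit_invariant.
move=> G GV bG; apply: cvg0_within_pinfty => [t|e e0]; first exact: semidist_ge0.
(* Otherwise every stage has a point farther than [e] from [A], yet such points cluster at a point
   of [A]. *)
have [n nP] : exists n, forall x, stage n x -> exists2 y, A y & `|x - y| <= e.
  apply: contrapT => /forallNP far.
  have /choice[u uP] n : exists x, stage n x /\ forall y, A y -> e < `|x - y|.
    have /existsNP[x /not_implyP[Kx nx]] := far n.
    exists x; split => // y Ay; rewrite ltNge; apply/negP => xy.
    by apply: nx; exists y.
  have [k|x Ax [g gP]] := cluster_stage (u := u); first exact: (uP k).1.
  have /cvgrPdist_lt/(_ _ e0)[n _ /(_ n (leqnn n))] := @cvg_harmonic R.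
  rewrite /= sub0r normrN ger0_norm// => ne.
  have := lt_trans (lt_trans ((uP (g n)).2 _ Ax) (gP n).2) ne.
  by rewrite ltxx.
have [a Ia aP] := absorbed_stage GV bG.
exists (a + n%:R * T) => t It tt; apply: semidist_le; first exact: ltW.
by move=> x /(aP _ _ It tt)/nP.
Qed.

(** Being bounded, [A] is carried into [D] by some [S(t)], and [S(t) A = A]. *)
Lemma omega_limit_sub_absorbing : A `<=` D.
Proof.
have AV := omega_limit_subV.
have bA : bounded_set A.
  apply: (bounded_subset omega_limit_sub_closure).
  exact/compact_bounded/(compact_closure_core d_gt0 q_gt0 q_lt1 stage_net E_tail).
have [t It tD] := D_absorbing.2 A AV bA.
by rewrite -(omega_limit_invariant It); exact: tD.
Qed.

End Attractor.
End Semigroup.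

(** * Invariance of closures and the final assembly *)

(** The estimate on [f] holds only on [B], so the closure must be known to lie in [B] before passing
    to the limit. *)
Lemma closure_invariant (R : realType) (X : normedModType R) (f : X -> X)
    (B E : set X) (L : R) : 0 < L ->
  (forall x y, B x -> B y -> `|f x - f y| <= L * `|x - y|) ->
  closure E `<=` B -> f @` E `<=` E -> f @` closure E `<=` closure E.
Proof.
move=> L0 fL EB fE _ [x Ex <-]; apply/mem_closure_dist => e e0.
have /mem_closure_dist/(_ _ (divr_gt0 e0 L0))[y Ey xy] := Ex.
exists (f y); first by apply: fE; exists y.
rewrite (le_lt_trans (fL _ _ _ _))//; [exact: EB|exact/EB/subset_closure|].
by rewrite mulrC -ltr_pdivlMr.
Qed.

Lemma elog_nat_le (R : realType) (b : R) (N : nat) (x : \bar R) :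
  1 < b -> (0 < N)%N -> (N%:R%:E <= x)%E -> (elog b N%:R%:E <= elog b x)%E.
Proof.
move=> b1 N0 Nx; apply: lee_wpmul2r; first by rewrite lee_fin invr_ge0 ln_ge0// ltW.
have N0x : (0 <= N%:R%:E :> \bar R)%E by rewrite lee_fin.
by rewrite lee_lne// in_itv /= leey andbT// (le_trans N0x).
Qed.

Theorem theorem5p3 (R : realType) (X : completeNormedModType R)
    (V : set X) (I : set R) (S : R -> X -> X) (T : R) (B : set X)
    (a : smoothing_space X) (eta kappa : R)
    (V_nonempty : V !=set0) (V_closed : closed V)
    (I_time : is_time_set I) (S_semigroup : semigroup I V S)
    (T_time : I T) (T_gt0 : 0 < T)
    (B_bounded : bounded_set B) (B_absorbing : absorbing I V S B)
    (S_or_B_closed : asymptotically_closed I V S \/ closed B)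
    (S_smoothing : smoothing_property a B (S T) eta kappa) :
  forall sigma : R, 0 < sigma -> sigma < 1 - eta ->
  exists M0 : set X,
    [/\ M0 `<=` B,
        discrete_exponential_attractor I V S T M0,
        (fractal_dim M0 <=
          elog (eta + sigma)^-1 (smoothing_packing a (sigma / (2 * kappa))))%E &
        asymptotically_closed I V S ->
          exists2 A : set X, global_attractor I V S A & A `<=` M0].
Proof.
move=> sigma sigma0 sigma1; have [eta0 eta1 _ _] := S_smoothing.
have [N [N0 NP coverB [L L0 SL]]] := smoothing_contracts_cover S_smoothing sigma0.
set q := eta + sigma in coverB *.
have q0 : 0 < q by rewrite /q; lra.
have q1 : q < 1 by rewrite /q; lra.
have [D [DB D_abs D_inv]] := absorbing_invariant I_time S_semigroup B_bounded B_absorbing.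
have D_bounded := bounded_subset DB B_bounded.
have [d d0 Dd] : exists2 d, 0 < d & forall x y, D x -> D y -> `|x - y| <= d.
  have /pinfty_ex_gt0[c c0 Dc] := D_bounded.
  exists (c + c) => [|x y Dx Dy]; first by rewrite addr_gt0.
  by rewrite (le_trans (ler_normB _ _))// lerD//; exact: Dc.
have stageD n : stage S T D n `<=` D by exact: stage_sub I_time T_time D_inv n.
have colK : forall n, colorable (stage S T D n) (N ^ n)
    (fun x y => `|x - y| <= d * q ^+ n).
  apply: (colorable_iter coverB d0 q0).
  - by move=> n; apply: subset_trans DB; exact: stageD.
  - exact: (stageS I_time S_semigroup T_time D_abs).
  - by move=> x y /stageD Dx /stageD; exact: Dd.
have [E [s [ED SE size_s s_sub [K_net E_tail]]]] :=
  stage_core I_time S_semigroup T_time T_gt0 D_abs D_inv N0 colK.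
have [z Dz] := absorbing_nonempty D_abs V_nonempty.
have attractor : asymptotically_closed I V S ->
    global_attractor I V S (omega_limit (stage S T D)) :=
  global_attractor_omega_limit I_time S_semigroup T_time T_gt0
  D_abs D_inv d0 q0 q1 s_sub K_net E_tail V_closed V_nonempty D_bounded.
have omegaD : asymptotically_closed I V S ->
    omega_limit (stage S T D) `<=` D :=
  omega_limit_sub_absorbing I_time S_semigroup T_time T_gt0
  D_abs D_inv d0 q0 q1 s_sub K_net E_tail V_closed D_bounded.
(* A closed [B] contains the closure of its subset [E]. In the other case [closure E] adds to [E]
   only points of the omega-limit set, which lies in [D]. *)
have EB : closure E `<=` B.
  case: S_or_B_closed => [/omegaD AD x|B_closed].
    by move=> /(closure_core_sub s_sub E_tail)[/ED/DB//|/AD/DB].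
  by rewrite (closure_id B).1//; apply: closure_subset; exact: subset_trans DB.
have dimE := fractal_dim_closure_core d0 q0 q1 N0 size_s s_sub K_net E_tail.
exists (closure E); split => //.
- split.
  + split; last exact: compact_closure_core d0 q0 q1 K_net E_tail.
    have [|w ws _] := K_net 0%N (S (0%:R * T) z); first by exists z.
    by exists w; apply: subset_closure; exact: s_sub ws.
  + by apply: subset_trans B_absorbing.1.
  + exact: closure_invariant L0 SL EB SE.
  + apply: le_lt_trans dimE _.
    by rewrite /elog lne_EFin ?ltr0n// -EFinM ltry.
  + apply: (exponential_attraction I_time S_semigroup T_time T_gt0 D_abs d0 q0 q1).
    move=> n x /K_net[w ws xw]; exists w => //.
    by apply: subset_closure; exact: s_sub ws.
- apply: (le_trans dimE); apply: elog_nat_le => //.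
  by rewrite invf_gt1.
- move=> /attractor gA; exists (omega_limit (stage S T D)) => //.
  exact: omega_limit_sub_core d0 q0 q1 s_sub K_net.
Qed.
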